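(* Let $f,g:[a,b]\to\mathbb{R}$ be absolutely $\beta$-integrable functions on $[a,b]$, and suppose that there exist real numbers $m$ and $M$ such that $m\le f(x)\le M$ for all $x\in[a,b]_\beta$. If $a<s_0<b$, then $$\left|T_\beta(f,g)\right|\le\frac12(M-m)\sqrt{T_\beta(g,g)} .$$
   Context: Setting: $I\subseteq\mathbb{R}$ is an interval, $a,b\in I$, and $\beta:I\to I$ is a strictly increasing continuous function with exactly one fixed point $s_0\in I$, satisfying $(t-s_0)(\beta(t)-t)\le 0$ for all $t\in I$, with equality only if $t=s_0$. Write $\beta^0(t)=t$ and $\beta^k$ for the $k$-fold composition of $\beta$ with itself. The $\beta$-interval is $[a,b]_\beta:=\{\beta^k(a):k\ge 0\}\cup\{\beta^k(b):k\ge 0\}\cup\{s_0\}$. The $\beta$-integral is $\int_a^b h\,d_\beta:=\int_{s_0}^b h\,d_\beta-\int_{s_0}^a h\,d_\beta$, where $\int_{s_0}^x h\,d_\beta:=\sum_{k=0}^{\infty}\big(\beta^k(x)-\beta^{k+1}(x)\big)h\big(\beta^k(x)\big)$; also written $\int_a^b h(x)\,d_\beta x$. The function $h$ is $\beta$-integrable on $[a,b]$ if these series converge for $x=a$ and $x=b$, and absolutely $\beta$-integrable on $[a,b]$ if $|h|$ is $\beta$-integrable on $[a,b]$. For two absolutely $\beta$-integrable functions $f,g:[a,b]\to\mathbb{R}$ on $[a,b]$, the Chebyshev functional is $$T_\beta(f,g):=\frac{1}{b-a}\int_a^b f(x)g(x)\,d_\beta x-\left(\frac{1}{b-a}\int_a^b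 f(x)\,d_\beta x\right)\left(\frac{1}{b-a}\int_a^b g(x)\,d_\beta x\right).$$ *)

(* Defs.v *)
From HB Require Import structures.
From mathcomp Require Import all_boot all_order all_algebra.
From mathcomp Require Import all_classical all_reals all_analysis.

Set Implicit Arguments.
Unset Strict Implicit.
Unset Printing Implicit Defensive.

Import Order.TTheory GRing.Theory Num.Theory.
Import numFieldNormedType.Exports.
Local Open Scope classical_set_scope.
Local Open Scope ring_scope.

(* Partial functions on I (or on [a, b]) are represented by total functions
   R -> R of which only the values on I (or on [a, b]) matter. *)
Record beta_function (R : realType) (I : set R) (beta : R -> R) (s0 : R)
    : Prop := BetaFunction {
  beta_maps : forall t, I t -> I (beta t);
  beta_increasing : forall s t, I s -> I t -> s < t -> beta s < beta t;
  beta_continuous : {within I, continuous beta};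
  beta_fixed_mem : I s0;
  beta_fixed : beta s0 = s0;
  beta_fixed_unique : forall t, I t -> beta t = t -> t = s0;
  beta_sign : forall t, I t -> (t - s0) * (beta t - t) <= 0;
  beta_sign_eq : forall t, I t -> (t - s0) * (beta t - t) = 0 -> t = s0 }.

Definition beta_interval (R : realType) (beta : R -> R) (s0 a b : R) : set R :=
  range (fun k : nat => iter k beta a) `|` range (fun k : nat => iter k beta b)
    `|` [set s0].

Definition beta_term (R : realType) (beta h : R -> R) (x : R) (k : nat) : R :=
  (iter k beta x - iter k.+1 beta x) * h (iter k beta x).

Definition beta_integrable (R : realType) (beta : R -> R) (a b : R)
    (h : R -> R) : Prop :=
  cvgn (series (beta_term beta h a)) /\ cvgn (series (beta_term beta h b)).

Definition beta_abs_integrable (R : realType) (beta : R -> R) (a b : R)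
    (h : R -> R) : Prop :=
  beta_integrable beta a b (fun x => `|h x|).

(* The beta-integral and the Chebyshev functional take extended real values, as
   the library's expectation, covariance and variance do: absolute
   beta-integrability of g does not entail that g ^ 2 is beta-integrable, and
   T_beta(g, g) is then +oo when a < s0 < b. On beta-integrable functions they
   are the usual real numbers: see beta_integral_fin and beta_chebyshev_fin. *)
Definition beta_integral0 (R : realType) (beta h : R -> R) (x : R) : \bar R :=
  (\sum_(0 <= k <oo) (beta_term beta h x k)%:E)%E.

Definition beta_integral (R : realType) (beta : R -> R) (a b : R)
    (h : R -> R) : \bar R :=
  (beta_integral0 beta h b - beta_integral0 beta h a)%E.

Definition beta_chebyshev (R : realType) (beta : R -> R) (a b : R)
    (f g : R -> R) : \bar R :=
  (((b - a)^-1)%:E * beta_integral beta a b (fun x => (f x * g x)%R)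
   - (((b - a)^-1)%:E * beta_integral beta a b f)
     * (((b - a)^-1)%:E * beta_integral beta a b g))%E.

Lemma beta_integral_fin (R : realType) (beta : R -> R) (a b : R) (h : R -> R) :
  beta_integrable beta a b h ->
  beta_integral beta a b h =
  (limn (series (beta_term beta h b)) - limn (series (beta_term beta h a)))%:E.
Proof.
have fin x : cvgn (series (beta_term beta h x)) ->
    beta_integral0 beta h x = (limn (series (beta_term beta h x)))%:E.
  move=> cx; rewrite -EFin_lim// /beta_integral0; congr (limn _).
  by apply/funext => n /=; rewrite sumEFin.
by case=> ca cb; rewrite /beta_integral !fin// -EFinB.
Qed.

Lemma beta_chebyshev_fin (R : realType) (beta : R -> R) (a b : R) (f g : R -> R) :
  beta_integrable beta a b f -> beta_integrable beta a b g ->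
  beta_integrable beta a b (fun x => f x * g x) ->
  let int h :=
    limn (series (beta_term beta h b)) - limn (series (beta_term beta h a)) in
  beta_chebyshev beta a b f g =
  ((b - a)^-1 * int (fun x => f x * g x)
   - ((b - a)^-1 * int f) * ((b - a)^-1 * int g))%:E.
Proof.
by move=> fi gi fgi /=; rewrite /beta_chebyshev !beta_integral_fin.
Qed.

(* Main.v *)
(* The orbit of [b] decreases to [s0] and the orbit of [a] increases to [s0], so
   [(b - a)^-1 * beta_integral beta a b] is the mean of a probability measure on
   the two orbits and [beta_chebyshev] is its covariance. If [g ^ 2] is
   beta-integrable, the bound is Cauchy-Schwarz together with
   [(f - c) ^ 2 <= K ^ 2], where [c] and [K] are the centre and half-length of
   [m, M]. Otherwise the variance of [g] is [+oo], and only [m = M] needs an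
   argument, the right-hand side then being [0 * +oo = 0]. *)

Require Import Defs.
From HB Require Import structures.
From mathcomp Require Import all_boot all_order all_algebra.
From mathcomp Require Import all_classical all_reals all_analysis.
From mathcomp Require Import ring lra.

Import Order.TTheory GRing.Theory Num.Theory.
Import numFieldNormedType.Exports.
Local Open Scope classical_set_scope.
Local Open Scope ring_scope.

(** * Monotone orbits and their convergence to the fixed point *)

Lemma iter_beta_mem {R : realType} {I : set R} {beta : R -> R} {s0 : R} :
  beta_function I beta s0 -> forall x, I x -> forall k, I (iter k beta x).
Proof. by move=> hb x Ix; elim=> [//|k IHk]; exact: (beta_maps hb). Qed.

(** Strict monotonicity keeps the image on the same side of [s0]. The sign condition moves it
    towards [s0], strictly since [t] is not fixed. *)
Lemma beta_contract_gt {R : realType} {I : set R} {beta : R -> R} {s0 : R} :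
  beta_function I beta s0 -> forall t, I t -> s0 < t -> s0 < beta t < t.
Proof.
move=> hb t It s0t; apply/andP; split.
  by rewrite -[X in X < _](beta_fixed hb); exact: (beta_increasing hb (beta_fixed_mem hb)).
have := beta_sign hb It; rewrite pmulr_rle0 ?subr_gt0// subr_le0 le_eqVlt.
by case/predU1P => // /(beta_fixed_unique hb It) ts0; rewrite ts0 ltxx in s0t.
Qed.

Lemma beta_contract_lt {R : realType} {I : set R} {beta : R -> R} {s0 : R} :
  beta_function I beta s0 -> forall t, I t -> t < s0 -> t < beta t < s0.
Proof.
move=> hb t It ts0; apply/andP; split; last first.
  by rewrite -[X in _ < X](beta_fixed hb); exact: (beta_increasing hb It (beta_fixed_mem hb)).
have := beta_sign hb It; rewrite nmulr_rle0 ?subr_lt0// subr_ge0 le_eqVlt.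
by case/predU1P => // /esym/(beta_fixed_unique hb It) ts; rewrite ts ltxx in ts0.
Qed.

Lemma iter_beta_gt {R : realType} {I : set R} {beta : R -> R} {s0 x : R} :
  beta_function I beta s0 -> I x -> s0 < x -> forall k,
  s0 < iter k beta x.
Proof.
move=> hb Ix s0x; elim=> [//|k IHk].
by have /andP[] := beta_contract_gt hb _ (iter_beta_mem hb _ Ix k) IHk.
Qed.

Lemma iter_beta_lt {R : realType} {I : set R} {beta : R -> R} {s0 x : R} :
  beta_function I beta s0 -> I x -> x < s0 -> forall k,
  iter k beta x < s0.
Proof.
move=> hb Ix xs0; elim=> [//|k IHk].
by have /andP[] := beta_contract_lt hb _ (iter_beta_mem hb _ Ix k) IHk.
Qed.

Lemma iter_beta_decr {R : realType} {I : set R} {beta : R -> R} {s0 x : R} :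
  beta_function I beta s0 -> I x -> s0 < x -> forall k,
  iter k.+1 beta x <= iter k beta x.
Proof.
move=> hb Ix s0x k; apply: ltW.
by have /andP[] := beta_contract_gt hb _ (iter_beta_mem hb _ Ix k)
  (iter_beta_gt hb Ix s0x k).
Qed.

Lemma iter_beta_incr {R : realType} {I : set R} {beta : R -> R} {s0 x : R} :
  beta_function I beta s0 -> I x -> x < s0 -> forall k,
  iter k beta x <= iter k.+1 beta x.
Proof.
move=> hb Ix xs0 k; apply: ltW.
by have /andP[] := beta_contract_lt hb _ (iter_beta_mem hb _ Ix k)
  (iter_beta_lt hb Ix xs0 k).
Qed.

Lemma iter_beta_lim_fixed {R : realType} {I : set R} {beta : R -> R} {s0 : R}
    (x l : R) :
  beta_function I beta s0 -> I x -> I l ->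
  iter k beta x @[k --> \oo] --> l -> l = s0.
Proof.
move=> hb Ix Il xl; apply: (beta_fixed_unique hb Il).
have /subspace_continuousP/(_ _ Il) cb := beta_continuous hb.
(* [beta] is continuous only relative to [I], so the convergence is first refined to [I], where the
   orbit stays. *)
have xlI : iter k beta x @[k --> \oo] --> within I (nbhs l).
  move=> A /= /xl /=; rewrite /nbhs/=; apply: filterS => k /=.
  by apply; exact: (iter_beta_mem hb).
have xbl : iter k.+1 beta x @[k --> \oo] --> beta l by exact: cvg_comp xlI cb.
have xl1 : iter k.+1 beta x @[k --> \oo] --> l.
  by rewrite (cvg_shiftS (fun k => iter k beta x)).
exact: (@cvg_unique R (@Rhausdorff R) _ _ _ _ xbl xl1).
Qed.

Lemma iter_beta_cvg_gt {R : realType} {I : set R} {beta : R -> R} {s0 x : R} :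
  is_interval I -> beta_function I beta s0 -> I x -> s0 < x ->
  iter k beta x @[k --> \oo] --> s0.
Proof.
move=> hI hb Ix s0x.
have lbx : has_lbound (range (fun k => iter k beta x)).
  by exists s0 => _ [k _ <-]; exact/ltW/(iter_beta_gt hb).
have ni : nonincreasing_seq (fun k => iter k beta x).
  by apply/nonincreasing_seqP => k; exact: (iter_beta_decr hb).
have := nonincreasing_cvgn ni lbx; set l := inf _ => xl.
suff <- : l = s0 by [].
apply: (iter_beta_lim_fixed x l hb) => //.
(* The limit lies between [s0] and [x], hence in the interval [I], where continuity can be used. *)
apply: (hI s0 x) => //; first exact: (beta_fixed_mem hb).
apply/andP; split.
  apply: lb_le_inf; first by exists x, 0%N.
  by move=> _ [k _ <-]; exact/ltW/(iter_beta_gt hb).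
by apply: ge_inf => //; exists 0%N.
Qed.

Lemma iter_beta_cvg_lt {R : realType} {I : set R} {beta : R -> R} {s0 x : R} :
  is_interval I -> beta_function I beta s0 -> I x -> x < s0 ->
  iter k beta x @[k --> \oo] --> s0.
Proof.
move=> hI hb Ix xs0.
have ubx : has_ubound (range (fun k => iter k beta x)).
  by exists s0 => _ [k _ <-]; exact/ltW/(iter_beta_lt hb).
have nd : nondecreasing_seq (fun k => iter k beta x).
  by apply/nondecreasing_seqP => k; exact: (iter_beta_incr hb).
have := nondecreasing_cvgn nd ubx; set l := sup _ => xl.
suff <- : l = s0 by [].
apply: (iter_beta_lim_fixed x l hb) => //.
apply: (hI x s0) => //; first exact: (beta_fixed_mem hb).
apply/andP; split.
  by apply: ub_le_sup => //; exists 0%N.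
apply: ge_sup; first by exists x, 0%N.
by move=> _ [k _ <-]; exact/ltW/(iter_beta_lt hb).
Qed.

(** * Convergence and divergence of the defining series *)

(** The partial sums telescope to [x - iter n beta x]. *)
Lemma cvg_series_beta_term1 {R : realType} {beta : R -> R} {s0 x : R} :
  iter k beta x @[k --> \oo] --> s0 ->
  series (beta_term beta (fun=> 1) x) @ \oo --> x - s0.
Proof.
move=> xs0; rewrite (_ : series _ = fun n => x - iter n beta x).
  by apply: cvgB => //; exact: cvg_cst.
apply/funext => n; rewrite /series /=.
elim: n => [|n IHn]; first by rewrite big_geq// subrr.
by rewrite big_nat_recr//= IHn /beta_term mulr1 addrA subrK.
Qed.

(** Comparison test. On a monotone orbit the weights have constant sign, so convergence of the
    series of [|h2|] is absolute convergence of that of [h2]. *)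
Lemma cvg_series_beta_term_le {R : realType} {beta : R -> R} {x : R}
    (h1 h2 : R -> R) (C : R) :
  (forall k, iter k.+1 beta x <= iter k beta x) \/
  (forall k, iter k beta x <= iter k.+1 beta x) ->
  (forall k, `|h1 (iter k beta x)| <= C * `|h2 (iter k beta x)|) ->
  cvgn (series (beta_term beta (fun y => `|h2 y|) x)) ->
  cvgn (series (beta_term beta h1 x)).
Proof.
move=> mono h12 c2.
have ac2 : cvgn (series (C *: (fun k => `|beta_term beta h2 x k|))).
  apply: is_cvg_seriesZ; case: mono => mono.
    rewrite (_ : (fun k => _) = beta_term beta (fun y => `|h2 y|) x)//.
    by apply/funext => k; rewrite /beta_term normrM ger0_norm// subr_ge0.
  rewrite (_ : (fun k => _) = - beta_term beta (fun y => `|h2 y|) x).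
    by rewrite is_cvg_seriesN.
  apply/funext => k; rewrite fctE /beta_term normrM.
  by rewrite ler0_norm ?subr_le0// mulNr.
apply: normed_cvg; apply: series_le_cvg ac2 => k //=.
- rewrite fctE /beta_term -[_ *: _]/(_ * _) normrM mulrCA mulr_ge0//.
  exact: le_trans (h12 k).
- by rewrite fctE /beta_term -[_ *: _]/(_ * _) !normrM mulrCA ler_wpM2l.
Qed.

Lemma beta_integral0_pinfty {R : realType} {beta : R -> R} {x : R}
    (h : R -> R) :
  (forall k, iter k.+1 beta x <= iter k beta x) ->
  (forall k, 0 <= h (iter k beta x)) ->
  ~ cvgn (series (beta_term beta h x)) ->
  beta_integral0 beta h x = +oo%E.
Proof.
move=> decr h0 ncvg; apply: (cvg_lim (@ereal_hausdorff R)).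
rewrite (_ : (fun n => _) = fun n => (series (beta_term beta h x) n)%:E).
  apply/cvgeryP/nondecreasing_dvgn_lt => //; apply: nondecreasing_series => k _ _.
  by rewrite mulr_ge0// subr_ge0.
by apply/funext => n; rewrite sumEFin.
Qed.

(** On an increasing orbit the weights are nonpositive: the negated partial sums are nondecreasing,
    so if they diverge they tend to [+oo]. *)
Lemma beta_integral0_ninfty {R : realType} {beta : R -> R} {x : R}
    (h : R -> R) :
  (forall k, iter k beta x <= iter k.+1 beta x) ->
  (forall k, 0 <= h (iter k beta x)) ->
  ~ cvgn (series (beta_term beta h x)) ->
  beta_integral0 beta h x = -oo%E.
Proof.
move=> incr h0 ncvg; apply: (cvg_lim (@ereal_hausdorff R)).
rewrite (_ : (fun n => _) = fun n => (series (beta_term beta h x) n)%:E).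
  apply/cvgerNyP/cvgNry.
  rewrite (_ : - _ = series (- beta_term beta h x)); last first.
    by apply/funext => n; rewrite fctE /series/= -sumrN.
  apply/nondecreasing_dvgn_lt; last by rewrite is_cvg_seriesN.
  apply: nondecreasing_series => k _ _.
  by rewrite fctE oppr_ge0 mulr_le0_ge0// subr_le0.
by apply/funext => n; rewrite sumEFin.
Qed.

(** The part at [b] is finite or [+oo] and the part at [a] is finite or [-oo], so their difference
    is never indeterminate. *)
Lemma beta_integral_pinfty {R : realType} {beta : R -> R} {a b : R}
    (h : R -> R) :
  (forall k, iter k beta a <= iter k.+1 beta a) ->
  (forall k, iter k.+1 beta b <= iter k beta b) ->
  (forall k, 0 <= h (iter k beta a)) -> (forall k, 0 <= h (iter k beta b)) ->
  ~ beta_integrable beta a b h -> beta_integral beta a b h = +oo%E.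
Proof.
have fin x : cvgn (series (beta_term beta h x)) ->
    exists r : R, beta_integral0 beta h x = r%:E.
  move=> cx; exists (limn (series (beta_term beta h x))).
  rewrite -EFin_lim// /beta_integral0; congr (limn _).
  by apply/funext => n /=; rewrite sumEFin.
move=> incr decr ha hb nint; rewrite /beta_integral.
have [cb|ncb] := pselect (cvgn (series (beta_term beta h b))).
  rewrite (beta_integral0_ninfty _ incr ha) => [|ca]; last exact: nint.
  by have [r ->] := fin _ cb.
rewrite (beta_integral0_pinfty _ decr hb ncb).
have [ca|nca] := pselect (cvgn (series (beta_term beta h a))).
  by have [r ->] := fin _ ca.
by rewrite (beta_integral0_ninfty _ incr ha nca).
Qed.

(** * Means as limits of partial sums *)

(** A relation with a real limit, so that linear combinations follow from limit arithmetic without a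
    new integrability proof for each. *)
Definition has_beta_mean {R : realType} (beta : R -> R) (a b : R) (h : R -> R)
    (l : R) : Prop :=
  (b - a)^-1 * (series (beta_term beta h b) n - series (beta_term beta h a) n)
    @[n --> \oo] --> l.

Lemma has_beta_mean_unique {R : realType} {beta : R -> R} {a b : R} (h : R -> R)
    (l l' : R) :
  has_beta_mean beta a b h l -> has_beta_mean beta a b h l' -> l = l'.
Proof. by move=> hl hl'; exact: (@cvg_unique R (@Rhausdorff R) _ _ _ _ hl hl'). Qed.

Lemma has_beta_mean_integrable {R : realType} {beta : R -> R} {a b : R}
    (h : R -> R) :
  beta_integrable beta a b h ->
  has_beta_mean beta a b h ((b - a)^-1 *
    (limn (series (beta_term beta h b)) - limn (series (beta_term beta h a)))).
Proof. by case=> ca cb; apply: cvgM; [exact: cvg_cst | exact: cvgB]. Qed.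

Lemma has_beta_mean_lin {R : realType} {beta : R -> R} {a b : R}
    (c : R) (h1 h2 : R -> R) (l1 l2 : R) :
  has_beta_mean beta a b h1 l1 -> has_beta_mean beta a b h2 l2 ->
  has_beta_mean beta a b (fun x => c * h1 x + h2 x) (c * l1 + l2).
Proof.
move=> hl1 hl2.
have lin x n : series (beta_term beta (fun x => c * h1 x + h2 x) x) n =
    c * series (beta_term beta h1 x) n + series (beta_term beta h2 x) n.
  rewrite /series/= mulr_sumr -big_split; apply: eq_bigr => k _.
  by rewrite /beta_term/=; ring.
rewrite /has_beta_mean; under eq_fun do rewrite !lin.
apply: cvg_trans (cvgD (cvgM (cvg_cst c) hl1) hl2); apply: near_eq_cvg.
by apply: nearW => n /=; rewrite fctE /=; ring.
Qed.

Lemma has_beta_mean_eq {R : realType} {beta : R -> R} {a b : R}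
    (h1 h2 : R -> R) (l : R) :
  (forall k, h1 (iter k beta a) = h2 (iter k beta a)) ->
  (forall k, h1 (iter k beta b) = h2 (iter k beta b)) ->
  has_beta_mean beta a b h1 l -> has_beta_mean beta a b h2 l.
Proof.
have eq x : (forall k, h1 (iter k beta x) = h2 (iter k beta x)) ->
    beta_term beta h1 x = beta_term beta h2 x.
  by move=> e; apply/funext => k; rewrite /beta_term e.
by move=> ea eb; rewrite /has_beta_mean (eq a)// (eq b).
Qed.

Lemma has_beta_mean_ge0 {R : realType} {beta : R -> R} {a b : R}
    (h : R -> R) (l : R) : a < b ->
  (forall k, iter k beta a <= iter k.+1 beta a) ->
  (forall k, iter k.+1 beta b <= iter k beta b) ->
  (forall k, 0 <= h (iter k beta a)) -> (forall k, 0 <= h (iter k beta b)) ->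
  has_beta_mean beta a b h l -> 0 <= l.
Proof.
move=> ab incr decr ha hb hl; rewrite -(cvg_lim (@Rhausdorff R) hl).
apply: limr_ge; first by apply/cvg_ex; exists l.
apply: nearW => n; rewrite mulr_ge0 ?invr_ge0 ?subr_ge0 ?(ltW ab)//.
(* Termwise, the contribution of [a] is at most 0 and that of [b] at least 0. *)
rewrite ler_sum// => k _; apply: (@le_trans _ _ 0).
  by rewrite mulr_le0_ge0// subr_le0.
by rewrite mulr_ge0// subr_ge0.
Qed.

Lemma has_beta_mean1 {R : realType} {beta : R -> R} {a b s0 : R} : a < b ->
  iter k beta a @[k --> \oo] --> s0 -> iter k beta b @[k --> \oo] --> s0 ->
  has_beta_mean beta a b (fun=> 1) 1.
Proof.
move=> ab /cvg_series_beta_term1 ca /cvg_series_beta_term1 cb.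
have {2}<- : (b - a)^-1 * (b - s0 - (a - s0)) = 1.
  rewrite (_ : b - s0 - (a - s0) = b - a); last by ring.
  by rewrite mulVf// subr_eq0 gt_eqF.
by apply: cvgM; [exact: cvg_cst | exact: cvgB].
Qed.

(** * Cauchy-Schwarz through a discriminant *)

(** A nonnegative polynomial of degree at most two has nonpositive discriminant; only the size is
    bounded, so [A = 0] is covered. *)
Lemma quadratic_ge0_discr {R : rcfType} (A B C : R) :
  (forall t, 0 <= C + 2 * t * B + t ^+ 2 * A) -> B ^+ 2 <= C * A.
Proof.
move=> q; pose p := A *: 'X^2 + (2 * B) *: 'X + C%:P.
have sp : (size p <= 3)%N.
  rewrite /p; apply: leq_trans (size_polyD _ _) _; rewrite geq_max.
  rewrite (leq_trans (size_polyC_leq1 _))// andbT.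
  apply: leq_trans (size_polyD _ _) _; rewrite geq_max.
  rewrite (leq_trans (size_scale_leq _ _)) ?size_polyXn//=.
  by rewrite (leq_trans (size_scale_leq _ _)) ?size_polyX.
have := deg_le2_poly_ge0 sp; rewrite /p !coefE/= => H.
have : (2 * B) ^+ 2 - 4 * A * C <= 0.
  have -> : (2 * B) ^+ 2 - 4 * A * C =
    (A * 0 + 2 * B * 1 + 0) ^+ 2 - 4 * (A * 1 + 2 * B * 0 + 0) * (A * 0 + 2 * B * 0 + C).
    by ring.
  apply: H => x; rewrite !hornerE/=.
  by rewrite (_ : _ + _ = C + 2 * x * B + x ^+ 2 * A) ?q//; ring.
by rewrite exprMn; lra.
Qed.

(* To do without a mean of [f ^ 2], use the mean of
   [K ^ 2 + 2 t (f - c) (g - Eg) + t ^ 2 (g - Eg) ^ 2], which is nonnegative for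
   every [t]; the discriminant of this quadratic in [t] is the claim. *)
Lemma sqr_beta_covariance_le {R : realType} {beta : R -> R} {a b : R}
    (f g : R -> R) (m M Ef Eg Efg Eg2 : R) : a < b ->
  (forall k, iter k beta a <= iter k.+1 beta a) ->
  (forall k, iter k.+1 beta b <= iter k beta b) ->
  (forall k, m <= f (iter k beta a) <= M) ->
  (forall k, m <= f (iter k beta b) <= M) ->
  has_beta_mean beta a b (fun=> 1) 1 ->
  has_beta_mean beta a b f Ef -> has_beta_mean beta a b g Eg ->
  has_beta_mean beta a b (fun x => f x * g x) Efg ->
  has_beta_mean beta a b (fun x => g x * g x) Eg2 ->
  (Efg - Ef * Eg) ^+ 2 <= (2^-1 * (M - m)) ^+ 2 * (Eg2 - Eg * Eg).
Proof.
move=> ab incr decr fa fb h1 hf hg hfg hg2.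
apply: quadratic_ge0_discr => t.
set K := 2^-1 * (M - m); pose c := 2^-1 * (M + m).
(* The constant term of the expanded quadratic, less 1: the innermost combination below is
   [d * 1 + 1]. *)
pose d := K ^+ 2 + 2 * t * c * Eg + t ^+ 2 * Eg ^+ 2 - 1.
have := has_beta_mean_lin (2 * t) _ _ _ _ hfg
  (has_beta_mean_lin (t ^+ 2) _ _ _ _ hg2
  (has_beta_mean_lin (- (2 * t * c + 2 * t ^+ 2 * Eg)) _ _ _ _ hg
  (has_beta_mean_lin (- (2 * t * Eg)) _ _ _ _ hf
  (has_beta_mean_lin d _ _ _ _ h1 h1)))).
set h := fun x : R => _; set l := (X in has_beta_mean _ _ _ _ X) => hl.
have -> : K ^+ 2 + 2 * t * (Efg - Ef * Eg) + t ^+ 2 * (Eg2 - Eg * Eg) = l.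
  by rewrite /l /d; ring.
have h_ge0 x : m <= f x <= M -> 0 <= h x.
  move=> /andP[mf fM].
  (* Completing the square leaves [K ^ 2 - (f x - c) ^ 2], which factors as
     [(M - f x) * (f x - m)]. *)
  have -> : h x = (M - f x) * (f x - m) + (f x - c + t * (g x - Eg)) ^+ 2.
    by rewrite /h /d /K /c; field.
  by rewrite addr_ge0 ?sqr_ge0// mulr_ge0// subr_ge0.
by apply: has_beta_mean_ge0 hl => // k; exact: h_ge0.
Qed.

Theorem corollary3p7 (R : realType) (I : set R) (beta : R -> R) (s0 a b : R)
  (f g : R -> R) (m M : R)
  (hI : is_interval I) (hbeta : beta_function I beta s0)
  (ha : I a) (hb : I b)
  (hf : beta_abs_integrable beta a b f) (hg : beta_abs_integrable beta a b g)
  (hmM : forall x, beta_interval beta s0 a b x -> m <= f x <= M)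
  (has0 : a < s0) (hs0b : s0 < b) :
  (`|beta_chebyshev beta a b f g|
     <= (2^-1 * (M - m))%:E * sqrte (beta_chebyshev beta a b g g))%E.
Proof.
have ab : a < b by exact: lt_trans hs0b.
have incr := iter_beta_incr hbeta ha has0.
have decr := iter_beta_decr hbeta hb hs0b.
have fa k : m <= f (iter k beta a) <= M by apply: hmM; left; left; exists k.
have fb k : m <= f (iter k beta b) <= M by apply: hmM; left; right; exists k.
have mM : m <= M by have /andP[/le_trans] := fa 0%N; apply.
have mean1 : has_beta_mean beta a b (fun=> 1) 1.
  by apply: has_beta_mean1 => //;
    [exact: (iter_beta_cvg_lt hI hbeta) | exact: (iter_beta_cvg_gt hI hbeta)].
have integrable_le h h' C : beta_abs_integrable beta a b h' ->
    (forall k, `|h (iter k beta a)| <= C * `|h' (iter k beta a)|) ->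
    (forall k, `|h (iter k beta b)| <= C * `|h' (iter k beta b)|) ->
    beta_integrable beta a b h.
  move=> [ca cb] la lb; split.
    by apply: (cvg_series_beta_term_le _ _ _ _ la ca); right.
  by apply: (cvg_series_beta_term_le _ _ _ _ lb cb); left.
have fi : beta_integrable beta a b f.
  by apply: (integrable_le _ _ 1 hf) => k; rewrite mul1r.
have gi : beta_integrable beta a b g.
  by apply: (integrable_le _ _ 1 hg) => k; rewrite mul1r.
(* On the orbits [f] is bounded, so [f * g] is dominated by a multiple of [g]. *)
have f_le x : m <= f x <= M -> `|f x * g x| <= (`|m| + `|M|) * `|g x|.
  move=> /andP[mf fM]; rewrite normrM ler_wpM2r// ler_norml.
  have := ler_norm M; have := ler_norm (- m); rewrite normrN.
  by have := normr_ge0 m; have := normr_ge0 M; lra.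
have fgi : beta_integrable beta a b (fun x => f x * g x).
  by apply: (integrable_le _ _ _ hg) => k; exact: f_le.
have hfm := has_beta_mean_integrable _ fi.
have hgm := has_beta_mean_integrable _ gi.
have hfgm := has_beta_mean_integrable _ fgi.
rewrite (beta_chebyshev_fin fi gi fgi)/=.
have [g2i|ng2i] := pselect (beta_integrable beta a b (fun x => g x * g x)).
  have hg2m := has_beta_mean_integrable _ g2i.
  rewrite (beta_chebyshev_fin gi gi g2i)/=.
  have := sqr_beta_covariance_le _ _ _ _ _ _ _ _ ab incr decr fa fb mean1
    hfm hgm hfgm hg2m.
  (* Square roots of both sides; the half-length is its own absolute value since [m <= M]. *)
  move=> /ler_wsqrtr; rewrite sqrtr_sqr sqrtrM ?sqr_ge0// sqrtr_sqr.
  by rewrite (ger0_norm (mulr_ge0 _ _)) ?subr_ge0 ?invr_ge0.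
(* The mean of [g ^ 2] is [+oo], and the square subtracted from it is finite. *)
have -> : beta_chebyshev beta a b g g = +oo%E.
  rewrite /beta_chebyshev beta_integral_pinfty// => [|k|k]; try exact: sqr_ge0.
  by rewrite beta_integral_fin// gt0_muley ?lte_fin ?invr_gt0 ?subr_gt0.
rewrite /=; have [mltM|] := ltP m M.
  by rewrite gt0_muley ?leey// lte_fin mulr_gt0 ?subr_gt0.
move=> Mm; have {Mm} Mm : M = m by apply/eqP; rewrite eq_le mM Mm.
subst M.
have fE x : m <= f x <= m -> f x = m by move=> /le_anti.
(* Here [f] equals [m] on both orbits. To fit the linearity lemma, [m] is written [(m - 1) * 1 + 1],
   and [m * g] as [(m - 1) * g + g]; the covariance then vanishes. *)
have fm := has_beta_mean_unique _ _ _ hfm (has_beta_mean_eq _ _ _ _ _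
  (has_beta_mean_lin (m - 1) _ _ _ _ mean1 mean1)).
have fgm := has_beta_mean_unique _ _ _ hfgm (has_beta_mean_eq _ _ _ _ _
  (has_beta_mean_lin (m - 1) _ _ _ _ hgm hgm)).
rewrite fm ?fgm => [|k|k|k|k]; try by rewrite fE//; ring.
rewrite [X in `|X|%R](_ : _ = 0); last by ring.
by rewrite normr0 subrr mulr0 mul0e.
Qed.
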